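(* Let $q=ef+1$ be a prime power, with $e,f>1$, and let $\epsilon>1$ be a proper divisor of $e$ (so $e>\epsilon$). Suppose $C_0^\epsilon$ is a $(q,\frac{q-1}{\epsilon},\lambda)$-difference set (here $\lambda=\frac{q-1-\epsilon}{\epsilon^2}$), and let ${C_0^\epsilon}'=\{C_0^e,C_\epsilon^e,\ldots,C_{e-\epsilon}^e\}$. (i) If $\phi_i\neq\phi_j$ for some distinct $i,j\in\{1,\ldots,\epsilon-1\}$, then ${C_0^\epsilon}'$ is neither a disjoint partial difference family nor an external partial difference family. (ii) Otherwise, ${C_0^\epsilon}'$ is a $(q,\frac{e}{\epsilon},f,\frac{f-1}{\epsilon})$-disjoint difference family and a $(q,\frac{e}{\epsilon},f,\frac{(e-\epsilon)f}{\epsilon^2})$-external difference family. In particular, ${C_0^\epsilon}'$ cannot be a proper disjoint partial difference family nor a proper external partial difference family.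
   Context: $G=(GF(q),+)$, $G^*=G\setminus\{0\}$; $\alpha$ a primitive element; $C_i^d=\alpha^i\langle\alpha^d\rangle$ for $d\mid q-1$. For $0\le i\le\epsilon-1$, $\Phi_i=\{x\in C_0^e:x\neq1,\ x-1\in\alpha^iC_0^\epsilon\}$ and $\phi_i=|\Phi_i|$. $\Delta(D)$ is the multiset $\{x-y:x,y\in D,x\neq y\}$, $\Delta(D_1,D_2)$ the multiset $\{x-y:x\in D_1,y\in D_2\}$, $\lambda A$ is $\lambda$ copies of each element of $A$. $D$ is a $(q,k,\lambda)$-difference set if $|D|=k$ and $\Delta(D)=\lambda G^*$. For a family of $m$ disjoint $k$-subsets $D_i$ of $G^*$ with union $S$: $(q,m,k,\lambda)$-disjoint difference family means $\bigcup_i\Delta(D_i)=\lambda G^*$; $(q,m,k,\lambda)$-external difference family means $\bigcup_{i\neq j}\Delta(D_i,D_j)=\lambda G^*$; disjoint (resp. external) partial difference family means $\bigcup_i\Delta(D_i)$ (resp. $\bigcup_{i\neq j}\Delta(D_i,D_j)$) equals $\lambda S+\mu(G^*\setminus S)$ for some $\lambda,\mu$, proper if $\lambda\neq\mu$. *)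

(* Defs.v *)
From mathcomp Require Import all_boot all_order all_algebra all_field.

Set Implicit Arguments.
Unset Strict Implicit.
Unset Printing Implicit Defensive.

Import GRing.Theory.
Local Open Scope ring_scope.

(* Multisets over F are represented by sequences up to perm_eq; multiset union
   is concatenation. *)
Section Defs.
Variable F : finFieldType.

(* exponents below #|F| exhaust the cyclic group generated by alpha ^+ d *)
Definition cyc_class (alpha : F) (d i : nat) : {set F} :=
  [set alpha ^+ i * (alpha ^+ d) ^+ j | j : 'I_#|F|].

Definition Phi (alpha : F) (e epsilon i : nat) : {set F} :=
  [set x in cyc_class alpha e 0 |
    (x != 1) &&
    (x - 1 \in [set alpha ^+ i * y | y in cyc_class alpha epsilon 0])].

Definition phi (alpha : F) (e epsilon i : nat) : nat :=
  #|Phi alpha e epsilon i|.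

Definition Gstar : {set F} := [set~ 0].

Definition copies (n : nat) (A : {set F}) : seq F := flatten (nseq n (enum A)).

Definition Delta (D : {set F}) : seq F :=
  [seq x - y | x <- enum D, y <- enum (D :\ x)].

Definition Delta2 (D1 D2 : {set F}) : seq F :=
  [seq x - y | x <- enum D1, y <- enum D2].

Definition difference_set (q k lambda : nat) (D : {set F}) : Prop :=
  [/\ #|F| = q, #|D| = k & perm_eq (Delta D) (copies lambda Gstar)].

Definition disjoint_family (q m k : nat) (D : 'I_m -> {set F}) : Prop :=
  [/\ #|F| = q,
      forall i, D i \subset Gstar,
      forall i, #|D i| = k
    & forall i j, i != j -> [disjoint D i & D j]].

Definition family_union m (D : 'I_m -> {set F}) : {set F} :=
  \bigcup_(i < m) D i.

Definition internal_diffs m (D : 'I_m -> {set F}) : seq F :=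
  \big[cat/[::]]_(i < m) Delta (D i).

Definition external_diffs m (D : 'I_m -> {set F}) : seq F :=
  \big[cat/[::]]_(i < m) \big[cat/[::]]_(j < m | i != j) Delta2 (D i) (D j).

Definition disjoint_difference_family (q m k lambda : nat)
    (D : 'I_m -> {set F}) : Prop :=
  disjoint_family q k D /\
  perm_eq (internal_diffs D) (copies lambda Gstar).

Definition external_difference_family (q m k lambda : nat)
    (D : 'I_m -> {set F}) : Prop :=
  disjoint_family q k D /\
  perm_eq (external_diffs D) (copies lambda Gstar).

Definition partial_multiset (lambda mu : nat) (S : {set F}) : seq F :=
  copies lambda S ++ copies mu (Gstar :\: S).

Definition dpdf_with (q m k lambda mu : nat) (D : 'I_m -> {set F}) : Prop :=
  disjoint_family q k D /\
  perm_eq (internal_diffs D) (partial_multiset lambda mu (family_union D)).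

Definition epdf_with (q m k lambda mu : nat) (D : 'I_m -> {set F}) : Prop :=
  disjoint_family q k D /\
  perm_eq (external_diffs D) (partial_multiset lambda mu (family_union D)).

Definition disjoint_partial_difference_family m (D : 'I_m -> {set F}) : Prop :=
  exists k lambda mu, dpdf_with #|F| k lambda mu D.

Definition external_partial_difference_family m (D : 'I_m -> {set F}) : Prop :=
  exists k lambda mu, epdf_with #|F| k lambda mu D.

Definition proper_dpdf m (D : 'I_m -> {set F}) : Prop :=
  exists k lambda mu, lambda <> mu /\ dpdf_with #|F| k lambda mu D.

Definition proper_epdf m (D : 'I_m -> {set F}) : Prop :=
  exists k lambda mu, lambda <> mu /\ epdf_with #|F| k lambda mu D.

(* the partition {C_0^e, C_epsilon^e, ..., C_{e - epsilon}^e} of C_0^epsilon *)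
Definition class_partition (alpha : F) (e epsilon : nat)
    (j : 'I_(e %/ epsilon)) : {set F} :=
  cyc_class alpha e (epsilon * j).

End Defs.

(* Main.v *)
Require Import Defs.
From mathcomp Require Import all_boot all_algebra all_fingroup all_field.
From mathcomp Require Import all_character zify.

(* Write S = C_0^epsilon.  If x - y = z with x and y in the same class of the
   partition, then u = x / y lies in C_0^e and u - 1 = z / y; hence every z in
   alpha^i S is an internal difference phi_i times, and an external one
   lambda - phi_i times.  So the partition is a partial difference family
   exactly when phi_1 = ... = phi_(epsilon - 1), and a proper one when phi_0
   differs from this common value.  The latter cannot happen: internal
   differences being symmetric, phi_0 is the phi_i of the class of -1, and
   i <> 0 because S <> - S.  Indeed, if a difference set S not containing 0
   satisfies S = - S, then each nontrivial additive character sums over S to a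
   square root of n = |S| - lambda, while all characters together sum to 0; so
   |S| is an integer multiple of the square root of n, and n divides |S|^2.
   Here n = 1 + lambda (epsilon - 1) is coprime to |S| and greater than 1. *)

Set Implicit Arguments.
Unset Strict Implicit.
Unset Printing Implicit Defensive.

Import GRing.Theory Num.Theory.
Local Open Scope ring_scope.

Section DifferenceCounts.
Variable V : finZmodType.
Implicit Types (A B : {set V}) (z : V).

Definition diff_count A B z : nat := #|[set y in B | y + z \in A]|.

Lemma sum_diff_count (M : nmodType) (g : V -> M) A B :
  \sum_z g z *+ diff_count A B z = \sum_(x in A) \sum_(y in B) g (x - y).
Proof.
transitivity (\sum_z \sum_(y in B | y + z \in A) g z).
  apply: eq_bigr => z _; rewrite -sumr_const.
  by apply: eq_bigl => y; rewrite inE.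
rewrite (exchange_big_dep (mem B)) => [|z y _ /andP[]] //=.
rewrite [RHS]exchange_big; apply: eq_bigr => y By.
rewrite [RHS](reindex_inj (addrI y)) /= By.
by apply: eq_bigr => z _; rewrite addrC addKr.
Qed.

Lemma diff_countE A B z :
  diff_count A B z = (\sum_(x in A) \sum_(y in B) (x - y == z)%R)%N.
Proof.
rewrite -(sum_diff_count (fun w => (w == z) : nat)) (bigD1 z) //= eqxx natn.
by rewrite big1 ?addr0 // => w /negbTE ->; rewrite mul0rn.
Qed.

Lemma diff_count0 A : diff_count A A 0 = #|A|.
Proof. by apply: eq_card => y; rewrite inE addr0 andbb. Qed.

Lemma diff_countN A B z : diff_count B A (- z) = diff_count A B z.
Proof.
rewrite !diff_countE exchange_big; apply: eq_bigr => x _; apply: eq_bigr => y _.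
by rewrite -opprB eqr_opp.
Qed.

Lemma diff_count_bigcup (I : finType) (D : I -> {set V}) z :
  (forall i j, i != j -> [disjoint D i & D j]) ->
  diff_count (\bigcup_i D i) (\bigcup_i D i) z
  = (\sum_i \sum_j diff_count (D i) (D j) z)%N.
Proof.
move=> disjD; rewrite diff_countE partition_disjoint_bigcup //.
apply: eq_bigr => i _; under [RHS]eq_bigr do rewrite diff_countE.
rewrite [RHS]exchange_big; apply: eq_bigr => x _.
exact: partition_disjoint_bigcup.
Qed.

End DifferenceCounts.

Section AdditiveCharacters.
Variable V : finZmodType.
Implicit Types (i : Iirr [set: V]) (x y : V).

Lemma zmod_irr_lin_char i : 'chi_i \is a linear_char.
Proof. exact/char_abelianP/FinRing.zmod_abelian. Qed.

Lemma zmod_irr0 i : 'chi_i 0 = 1.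
Proof. exact/lin_char1/zmod_irr_lin_char. Qed.

Lemma zmod_irrD i x y : 'chi_i (x + y) = 'chi_i x * 'chi_i y.
Proof. by rewrite -lin_charM ?inE ?zmod_irr_lin_char. Qed.

Lemma row_sum_zmod_irr i : i != 0 -> \sum_x 'chi_i x = 0.
Proof.
move=> i_neq0; have := cfdot_irr i 0.
rewrite (negbTE i_neq0) cfdotE irr0 => /eqP.
rewrite mulf_eq0 invr_eq0 (negbTE (neq0CG _)) => /eqP sum0; rewrite -[RHS]sum0.
by apply: eq_big => x; rewrite ?cfun1E ?inE ?rmorph1 ?mulr1.
Qed.

Lemma column_sum_zmod_irr x :
  x != 0 -> \sum_(i : Iirr [set: V]) 'chi_i x = 0.
Proof.
move=> x_neq0; have := cfRegE [set: V] x.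
rewrite [x == _](negbTE x_neq0) cfReg_sum sum_cfunE mulr0n => sum0.
rewrite -[RHS]sum0; apply: eq_bigr => i _.
by rewrite cfunE [X in X * _]zmod_irr0 mul1r.
Qed.

End AdditiveCharacters.

Section ReversibleDifferenceSets.
Variables (V : finZmodType) (S : {set V}) (n lambda : nat).
Hypothesis S_diff : forall z : V, z != 0 -> diff_count S S z = lambda.
Hypothesis card_S : #|S| = (n + lambda)%N.
Hypothesis oppS : forall x, (- x \in S) = (x \in S).

Lemma reversible_diffset_char_sqr (i : Iirr [set: V]) :
  i != 0 -> (\sum_(s in S) 'chi_i s) ^+ 2 = n%:R.
Proof.
move=> i_neq0.
have -> : (\sum_(s in S) 'chi_i s) ^+ 2
          = \sum_(s in S) \sum_(t in S) 'chi_i (s - t).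
  rewrite expr2 mulr_suml; apply: eq_bigr => s _; rewrite mulr_sumr.
  rewrite (reindex_inj oppr_inj).
  by apply: eq_big => [t|t _]; rewrite ?oppS ?zmod_irrD.
rewrite -sum_diff_count (bigD1 0) //= diff_count0 zmod_irr0.
under eq_bigr => z z0 do rewrite S_diff //.
have /eqP := row_sum_zmod_irr i_neq0.
rewrite (bigD1 0) //= zmod_irr0 addrC addr_eq0 => /eqP sum_nonzero.
by rewrite sumrMnl sum_nonzero card_S mulrnDr mulNrn addrK.
Qed.

Lemma reversible_diffset_order_dvdn : 0 \notin S -> (n %| #|S| ^ 2)%N.
Proof.
move=> S_neq0; pose xi i := \sum_(s in S) 'chi[setT]_i s.
have sum_xi : \sum_i xi i = 0.
  rewrite exchange_big big1 //= => s Ss; apply: column_sum_zmod_irr.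
  by apply: contraNneq S_neq0 => <-.
have xi0 : xi 0 = #|S|%:R.
  by rewrite -sumr_const; apply: eq_bigr => s _; rewrite irr0 cfun1E inE.
have [M xi_M] : exists M : int, \sum_(i | i != 0) xi i = M%:~R * sqrtC n%:R.
  exists (\sum_(i | i != 0) (-1) ^+ (xi i != sqrtC n%:R)).
  rewrite rmorph_sum mulr_suml; apply: eq_bigr => i i_neq0.
  have /eqP : xi i ^+ 2 = n%:R by apply: reversible_diffset_char_sqr.
  rewrite -[n%:R in X in X -> _]sqrtCK eqf_sqr rmorphXn rmorphN1.
  by case: eqP => [-> _ | _ /= /eqP ->]; rewrite ?mul1r ?mulN1r.
have : (#|S|%:R : algC) ^+ 2 = M%:~R ^+ 2 * n%:R.
  move/eqP: sum_xi; rewrite (bigD1 0) //= xi0 xi_M addr_eq0 => /eqP ->.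
  by rewrite sqrrN exprMn sqrtCK.
rewrite -natrX -rmorphXn /= !pmulrn -rmorphM /= => /intr_inj cardS_sqr.
by apply/dvdnP; exists `|(M ^+ 2)%R|%N; rewrite -[LHS]absz_nat cardS_sqr abszM.
Qed.

End ReversibleDifferenceSets.

Lemma perm_eq_countP (T : eqType) (s t : seq T) :
  perm_eq s t <-> forall z, count_mem z s = count_mem z t.
Proof.
split=> [/seq.permP st z | st]; first exact: st.
by apply/allP => z _; apply/eqP/st.
Qed.

Section DifferenceFamilies.
Variable F : finFieldType.
Implicit Types (A B : {set F}) (q k c lambda mu : nat) (z : F).

Lemma count_mem_copies c A z : count_mem z (copies c A) = (c * (z \in A))%N.
Proof.
rewrite count_flatten map_nseq sumn_nseq mulnC.
by rewrite count_uniq_mem ?enum_uniq // mem_enum.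
Qed.

Lemma size_copies c A : size (copies c A) = (c * #|A|)%N.
Proof. by rewrite size_flatten /shape map_nseq sumn_nseq mulnC cardE. Qed.

Lemma count_mem_partial_multiset lambda mu A z : A \subset @Gstar F ->
  count_mem z (partial_multiset lambda mu A)
  = ((z != 0)%R * (if z \in A then lambda else mu))%N.
Proof.
move=> /subsetP/(_ z); rewrite count_cat !count_mem_copies !inE => A_neq0.
case: (z \in A) A_neq0 => [-> | _] //=; last by rewrite muln0 mulnC.
by rewrite muln1 muln0 addn0 mul1n.
Qed.

Lemma perm_partial_multiset_diag (s : seq F) c A : A \subset @Gstar F ->
  perm_eq s (partial_multiset c c A) = perm_eq s (copies c (@Gstar F)).
Proof.
move=> sAG; apply: (permPr _ s); apply/perm_eq_countP => z.
by rewrite count_mem_partial_multiset // count_mem_copies !inE if_same mulnC.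
Qed.

Lemma perm_partial_multisetP (s : seq F) lambda mu A :
    A \subset @Gstar F -> 0 \notin s ->
  perm_eq s (partial_multiset lambda mu A) <->
  forall z, z != 0 -> count_mem z s = if z \in A then lambda else mu.
Proof.
move=> sAG s0; rewrite perm_eq_countP; split=> cnt z.
  by move=> z0; rewrite cnt count_mem_partial_multiset // z0 mul1n.
rewrite count_mem_partial_multiset //; have [-> | z0] := eqVneq z 0.
  exact: count_memPn.
by rewrite cnt // mul1n.
Qed.

Lemma count_mem_Delta2 A B z : count_mem z (Delta2 A B) = diff_count A B z.
Proof.
rewrite diff_countE -sum1_count big_mkcond /= big_allpairs_dep big_enum /=.
apply: eq_bigr => x _; rewrite big_enum; apply: eq_bigr => y _.
by case: eqP.
Qed.

Lemma zero_notin_Delta A : 0 \notin Delta A.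
Proof.
apply/allpairsPdep => -[x [y [_]]]; rewrite mem_enum !inE => /andP[y_x _].
by move/esym/eqP; rewrite subr_eq0 eq_sym (negbTE y_x).
Qed.

Lemma count_mem_Delta A z : z != 0 -> count_mem z (Delta A) = diff_count A A z.
Proof.
move=> z0; rewrite diff_countE -sum1_count big_mkcond /= big_allpairs_dep.
rewrite big_enum; apply: eq_bigr => x Ax; rewrite big_enum [RHS](bigD1 x) //=.
rewrite subrr eq_sym (negbTE z0).
by apply: eq_big => y; rewrite ?inE 1?andbC //; case: eqP.
Qed.

Lemma size_Delta A : size (Delta A) = (#|A| * #|A|.-1)%N.
Proof.
rewrite size_allpairs_dep sumnE big_map big_enum -sum_nat_const.
by apply: eq_bigr => x Ax; rewrite -cardE (cardsD1 x A) Ax.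
Qed.

Lemma card_Gstar : #|@Gstar F| = #|F|.-1.
Proof. by rewrite cardsC1. Qed.

Lemma difference_set_count q k lambda A : difference_set q k lambda A ->
  forall z, z != 0 -> diff_count A A z = lambda.
Proof.
move=> [_ _ /perm_eq_countP cnt] z z0.
by rewrite -count_mem_Delta // cnt count_mem_copies !inE z0 muln1.
Qed.

Lemma difference_set_card q k lambda A : difference_set q k lambda A ->
  (k * k.-1 = lambda * q.-1)%N.
Proof.
by move=> [<- <- /perm_size]; rewrite size_Delta size_copies card_Gstar.
Qed.

Section DisjointFamilies.
Variables (m : nat) (D : 'I_m -> {set F}).

Definition internal_count z : nat := (\sum_j diff_count (D j) (D j) z)%N.

Lemma internal_countN z : internal_count (- z) = internal_count z.
Proof. by apply: eq_bigr => j _; apply: diff_countN. Qed.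

Lemma zero_notin_internal_diffs : 0 \notin internal_diffs D.
Proof.
elim/big_rec: (internal_diffs D) => // i s _.
by rewrite mem_cat negb_or zero_notin_Delta.
Qed.

Lemma count_mem_internal z : z != 0 ->
  count_mem z (internal_diffs D) = internal_count z.
Proof.
move=> z0; rewrite (big_morph _ (count_cat _) (erefl : count_mem z [::] = 0%N)).
by apply: eq_bigr => j _; apply: count_mem_Delta.
Qed.

Lemma ddf_card q k c : disjoint_difference_family q k c D ->
  (m * (k * k.-1) = c * q.-1)%N.
Proof.
move=> [[<- _ card_D _] /perm_size]; rewrite size_copies card_Gstar => <-.
rewrite (big_morph _ (@size_cat _) (erefl : size ([::] : seq F) = 0%N)).
rewrite (eq_bigr (fun=> k * k.-1)%N) ?sum_nat_const ?card_ord // => j _.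
by rewrite size_Delta card_D.
Qed.

Lemma family_union_sub_Gstar q k :
  disjoint_family q k D -> family_union D \subset @Gstar F.
Proof. by case=> _ sDG _ _; apply/bigcupsP => j _. Qed.

Lemma ddf_dpdf q k c :
  disjoint_difference_family q k c D <-> dpdf_with q k c c D.
Proof.
by split=> -[famD ints]; split=> //; move: ints;
  rewrite (perm_partial_multiset_diag _ _ (family_union_sub_Gstar famD)).
Qed.

Lemma edf_epdf q k c :
  external_difference_family q k c D <-> epdf_with q k c c D.
Proof.
by split=> -[famD ints]; split=> //; move: ints;
  rewrite (perm_partial_multiset_diag _ _ (family_union_sub_Gstar famD)).
Qed.

Lemma dpdfP q k lambda mu : disjoint_family q k D ->
  dpdf_with q k lambda mu D <->
  forall z, z != 0 ->
    internal_count z = if z \in family_union D then lambda else mu.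
Proof.
move=> famD; have sDG := family_union_sub_Gstar famD.
have permD := perm_partial_multisetP lambda mu sDG zero_notin_internal_diffs.
split=> [[_ /permD cnt] z z0 | cnt].
  by rewrite -count_mem_internal // cnt.
by split=> //; apply/permD => z z0; rewrite count_mem_internal // cnt.
Qed.

Lemma zero_notin_external_diffs q k :
  disjoint_family q k D -> 0 \notin external_diffs D.
Proof.
case=> _ _ _ disjD.
elim/big_rec: (external_diffs D) => // i s _ s0.
rewrite mem_cat negb_or s0 andbT; elim/big_rec: _ => // j t ij t0.
rewrite mem_cat negb_or t0 andbT.
apply/allpairsPdep => -[x [y []]]; rewrite !mem_enum => Dx Dy.
move/esym/eqP; rewrite subr_eq0 => /eqP xy.
by have /disjointFr/(_ Dx) := disjD _ _ ij; rewrite xy Dy.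
Qed.

Lemma count_mem_external q k z : disjoint_family q k D -> z != 0 ->
  (internal_count z + count_mem z (external_diffs D)
   = diff_count (family_union D) (family_union D) z)%N.
Proof.
case=> _ _ _ disjD z0; rewrite diff_count_bigcup //.
rewrite (big_morph _ (count_cat _) (erefl : count_mem z [::] = 0%N)) -big_split.
apply: eq_bigr => i _; rewrite [RHS](bigD1 i) //=; congr addn.
rewrite (big_morph _ (count_cat _) (erefl : count_mem z [::] = 0%N)).
apply: eq_big => [j|j _]; first by rewrite eq_sym.
exact: count_mem_Delta2.
Qed.

Lemma edf_card q k c : external_difference_family q k c D ->
  (m * (m.-1 * k ^ 2) = c * q.-1)%N.
Proof.
move=> [[<- _ card_D _] /perm_size]; rewrite size_copies card_Gstar => <-.
have size_bigcat :=
  big_morph _ (@size_cat F) (erefl : size ([::] : seq F) = 0%N).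
rewrite size_bigcat (eq_bigr (fun=> m.-1 * k ^ 2)%N) => [|i _].
  by rewrite sum_nat_const card_ord.
rewrite size_bigcat (eq_bigr (fun=> k ^ 2)%N) => [|j _].
  rewrite sum_nat_const; congr (_ * _)%N.
  rewrite -[X in X.-1]card_ord -(cardC1 i).
  by apply: eq_card => j; rewrite !inE eq_sym.
by rewrite size_allpairs -!cardE !card_D mulnn.
Qed.

Lemma internal_count_le q k z : disjoint_family q k D -> z != 0 ->
  (internal_count z <= diff_count (family_union D) (family_union D) z)%N.
Proof. by move=> famD z0; rewrite -(count_mem_external famD z0) leq_addr. Qed.

Lemma epdfP q k c lambda mu : disjoint_family q k D ->
    (forall z, z != 0 -> diff_count (family_union D) (family_union D) z = c) ->
  epdf_with q k lambda mu D <->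
  forall z, z != 0 ->
    (internal_count z + (if z \in family_union D then lambda else mu) = c)%N.
Proof.
move=> famD cD; have sDG := family_union_sub_Gstar famD.
have notin0 := zero_notin_external_diffs famD.
have permD := perm_partial_multisetP lambda mu sDG notin0.
split=> [[_ /permD cnt] z z0 | cnt].
  by rewrite -cnt // (count_mem_external famD) ?cD.
split=> //; apply/permD => z z0; apply: (@addnI (internal_count z)).
by rewrite (count_mem_external famD) // cD ?cnt.
Qed.

End DisjointFamilies.
End DifferenceFamilies.

Section CosetFamilies.
Variables (F : finFieldType) (H : {set F}) (m : nat) (D : 'I_m -> {set F}).
Local Notation S := (family_union D).
Hypothesis disjD : forall i j, i != j -> [disjoint D i & D j].
Hypothesis S_neq0 : 0 \notin S.
Hypothesis cosetD : forall j x y, y \in D j -> (x \in D j) = (x / y \in H).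

Lemma internal_count_coset z : z != 0 ->
  internal_count D z
  = #|[set u in H | (u != 1) && (z / (u - 1) \in S)]|.
Proof.
move=> z0.
have S_unit y : y \in S -> y != 0 by apply: contraTneq => ->.
transitivity (\sum_(y in S | (y + z) / y \in H) 1)%N.
  rewrite big_mkcondr partition_disjoint_bigcup //; apply: eq_bigr => j _.
  rewrite -big_mkcondr /diff_count -sum1_card; apply: eq_bigl => y; rewrite inE.
  by apply: andb_id2l => Dy; rewrite (cosetD _ Dy).
have ratioE y : y != 0 -> (y + z) / y = 1 + z / y.
  by move=> y0; rewrite mulrDl divff.
pose numer u := z / (u - 1); pose ratio y := (y + z) / y.
rewrite (reindex_onto numer ratio) /numer /ratio; last first.
  by move=> y /andP[/S_unit y0 _]; rewrite ratioE // addrC addKr divKf.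
rewrite -sum1_card; apply: eq_bigl => u; rewrite inE.
have [-> | u1] := eqVneq u 1.
  by rewrite subrr invr0 mulr0 (negbTE S_neq0) /= andbF.
have w0 : z / (u - 1) != 0 by rewrite mulf_neq0 ?invr_eq0 ?subr_eq0.
by rewrite ratioE // divKf // [1 + _]addrC subrK eqxx andbT andbC.
Qed.

End CosetFamilies.

Section CyclotomicClasses.
Variables (F : finFieldType) (alpha : F).
Local Notation n := #|F|.-1.
Local Notation C := (cyc_class alpha).
Hypothesis alpha_prim : n.-primitive_root alpha.
Implicit Types (d i j t : nat) (x y : F).

Let n_gt0 : (0 < n)%N. Proof. exact: prim_order_gt0 alpha_prim. Qed.
Let F_gt0 : (0 < #|F|)%N. Proof. by apply/card_gt0P; exists 0. Qed.

Lemma prim_root_neq0 : alpha != 0.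
Proof.
apply: contra_eq_neq (prim_expr_order alpha_prim) => ->.
by rewrite expr0n eqn0Ngt n_gt0 eq_sym oner_neq0.
Qed.

Lemma prim_root_log x : x != 0 -> exists t, x = alpha ^+ t.
Proof.
move=> x0; have /(prim_rootP alpha_prim)[t ->] : x ^+ n = 1; last by exists t.
by apply: (mulfI x0); rewrite mulr1 -exprS prednK ?expf_card.
Qed.

Lemma imset_mul_cyc_class d i : [set alpha ^+ i * y | y in C d 0] = C d i.
Proof.
rewrite /cyc_class -imset_comp; apply: eq_imset => j /=.
by rewrite expr0 mul1r.
Qed.

Lemma zero_notin_cyc_class d i : 0 \notin C d i.
Proof.
apply/imsetP => -[j _] /eqP.
by rewrite eq_sym -exprM mulf_eq0 !expf_eq0 (negbTE prim_root_neq0) !andbF.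
Qed.

Lemma mem_cyc_class_neq0 d i x : x \in C d i -> x != 0.
Proof. by apply: contraTneq => ->; apply: zero_notin_cyc_class. Qed.

Lemma mem1_cyc_class d : 1 \in C d 0.
Proof.
by apply/imsetP; exists (Ordinal F_gt0); rewrite //= !expr0 mul1r.
Qed.

Lemma mem_cyc_class_exp d i t : (d %| n)%N ->
  (alpha ^+ t \in C d i) = (t == i %[mod d])%N.
Proof.
move=> d_n; apply/imsetP/eqP => [[j _ /eqP] | t_i].
  rewrite -exprM -exprD (eq_prim_root_expr alpha_prim) => /eqP.
  by move=> /(congr1 (modn^~ d)); rewrite !modn_dvdm // addnC mulnC modnMDl.
have le_i : (i <= t + i * n)%N.
  by rewrite (leq_trans _ (leq_addl _ _)) ?leq_pmulr.
have /dvdnP[j Ej] : (d %| t + i * n - i)%N.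
  by rewrite -eqn_mod_dvd // -modnDmr (eqP (dvdn_mull i d_n)) addn0 t_i.
have j_lt : (j %% n < #|F|)%N by rewrite -(prednK F_gt0) ltnS ltnW ?ltn_pmod.
exists (Ordinal j_lt) => //=; apply/eqP.
rewrite -exprM -exprD (eq_prim_root_expr alpha_prim) -modnDmr modnMmr modnDmr.
by rewrite (mulnC d) -Ej subnKC // addnC modnMDl.
Qed.

Lemma cyc_class1 : C 1 0 = @Gstar F.
Proof.
apply/setP => x; rewrite !inE; have [-> | x0] := eqVneq x 0.
  by rewrite (negbTE (zero_notin_cyc_class _ _)).
by have [t ->] := prim_root_log x0; rewrite mem_cyc_class_exp ?dvd1n ?modn1.
Qed.

Lemma cyc_classP d x :
  (d %| n)%N -> x != 0 -> exists2 i, (i < d)%N & x \in C d i.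
Proof.
move=> d_n x0; have d_gt0 := dvdn_gt0 n_gt0 d_n.
have [t ->] := prim_root_log x0.
by exists (t %% d)%N; rewrite ?ltn_pmod // mem_cyc_class_exp ?modn_mod.
Qed.

Lemma cyc_classM d i j x y : (d %| n)%N ->
  y \in C d j -> (x * y \in C d (i + j)) = (x \in C d i).
Proof.
move=> d_n Cy; have y0 := mem_cyc_class_neq0 Cy.
have [-> | x0] := eqVneq x 0.
  by rewrite mul0r !(negbTE (zero_notin_cyc_class _ _)).
have [[s ->] [t Ey]] := (prim_root_log x0, prim_root_log y0).
move: Cy; rewrite Ey -exprD !mem_cyc_class_exp // => /eqP t_j.
by rewrite -modnDmr t_j modnDmr eqn_modDr.
Qed.

Lemma cyc_class_div d i x y : (d %| n)%N ->
  y \in C d i -> (x \in C d i) = (x / y \in C d 0).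
Proof.
move=> d_n Cy; rewrite -(cyc_classM 0 _ d_n Cy) divfK //.
exact: mem_cyc_class_neq0 Cy.
Qed.

Lemma cyc_class_disjoint d i j : (d %| n)%N ->
  (i < d)%N -> (j < d)%N -> i != j -> [disjoint C d i & C d j].
Proof.
move=> d_n i_d j_d /eqP ij; apply/pred0P => x; apply/negP => /= /andP[Cx].
have [t Ex] := prim_root_log (mem_cyc_class_neq0 Cx); move: Cx.
by rewrite Ex !mem_cyc_class_exp // => /eqP -> /eqP; rewrite !modn_small.
Qed.

End CyclotomicClasses.

Section ClassPartition.
Variables (F : finFieldType) (alpha : F) (e eps : nat).
Local Notation n := #|F|.-1.
Local Notation D := (@class_partition F alpha e eps).
Hypothesis alpha_prim : n.-primitive_root alpha.
Hypotheses (e_n : (e %| n)%N) (eps_e : (eps %| e)%N).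

Let e_gt0 : (0 < e)%N.
Proof. exact: dvdn_gt0 (prim_order_gt0 alpha_prim) e_n. Qed.
Let eps_gt0 : (0 < eps)%N. Proof. exact: dvdn_gt0 e_gt0 eps_e. Qed.

Lemma class_partition_disjoint i j : i != j -> [disjoint D i & D j].
Proof.
have lt_e (k : 'I_(e %/ eps)) : (eps * k < e)%N by rewrite mulnC -ltn_divRL.
by move=> ij; apply: cyc_class_disjoint => //; rewrite eqn_pmul2l.
Qed.

Lemma class_partition_union : family_union D = cyc_class alpha eps 0.
Proof.
have eps_n := dvdn_trans eps_e e_n.
have em : (eps * (e %/ eps))%N = e by rewrite mulnC divnK.
have m_gt0 : (0 < e %/ eps)%N by rewrite divn_gt0 // dvdn_leq.
apply/setP => x; apply/bigcupP/idP => [[j _ Dx] | Cx].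
  have x0 := mem_cyc_class_neq0 alpha_prim Dx.
  move: Dx; have [t ->] := prim_root_log alpha_prim x0.
  rewrite !mem_cyc_class_exp // => /eqP/(congr1 (modn^~ eps)).
  by rewrite !modn_dvdm // modnMr mod0n => ->.
have x0 := mem_cyc_class_neq0 alpha_prim Cx.
move: Cx; have [t ->] := prim_root_log alpha_prim x0.
rewrite mem_cyc_class_exp // mod0n => /dvdnP[s ->].
exists (Ordinal (ltn_pmod s m_gt0)) => //.
by rewrite mem_cyc_class_exp //= mulnC muln_modr em modn_mod.
Qed.

End ClassPartition.

Lemma card_cyc_class (F : finFieldType) (alpha : F) (d i : nat) :
    #|F|.-1.-primitive_root alpha -> (d %| #|F|.-1)%N ->
  #|cyc_class alpha d i| = (#|F|.-1 %/ d)%N.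
Proof.
move=> alpha_prim d_n.
have card_C j : #|cyc_class alpha d j| = #|cyc_class alpha d 0|.
  rewrite -imset_mul_cyc_class card_imset //.
  exact/mulfI/expf_neq0/prim_root_neq0.
have := class_partition_union alpha_prim d_n (dvd1n d).
move/(congr1 (fun A : {set F} => #|A|)).
rewrite cyc_class1 // card_Gstar -sum1_card.
rewrite partition_disjoint_bigcup; last exact: class_partition_disjoint.
under eq_bigr do rewrite sum1_card card_C.
rewrite sum_nat_const card_ord divn1 => <-.
by rewrite card_C mulKn // (dvdn_gt0 (prim_order_gt0 alpha_prim) d_n).
Qed.

Section PowerResidueDifferenceSets.
Variables (F : finFieldType) (alpha : F) (d q k lambda : nat).
Local Notation n := #|F|.-1.
Local Notation S := (cyc_class alpha d 0).
Hypothesis alpha_prim : n.-primitive_root alpha.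
Hypothesis d_n : (d %| n)%N.
Hypothesis diffset_S : difference_set q k lambda S.

Lemma power_residue_diffset_card : (n %/ d = 1 + lambda * d)%N.
Proof.
have n_gt0 := prim_order_gt0 alpha_prim; have d_gt0 := dvdn_gt0 n_gt0 d_n.
have k_gt0 : (0 < n %/ d)%N by rewrite divn_gt0 // dvdn_leq.
have [cardF cardS _] := diffset_S; have := difference_set_card diffset_S.
rewrite -cardF -cardS card_cyc_class // -[in RHS](divnK d_n) mulnCA => /eqP.
by rewrite eqn_pmul2l // => /eqP <-; rewrite add1n prednK.
Qed.

Lemma oppr1_notin_power_residue_diffset : (1 < d < n)%N -> -1 \notin S.
Proof.
case/andP=> d_gt1 d_lt_n; apply/negP => S_N1.
have card_res := power_residue_diffset_card.
pose order := (1 + lambda * d.-1)%N.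
have cardS : #|S| = (order + lambda)%N.
  by rewrite card_cyc_class // card_res /order; nia.
have oppS x : (- x \in S) = (x \in S).
  by rewrite -mulrN1 -{1}[0%N]addn0 (cyc_classM alpha_prim _ _ d_n S_N1).
have order_dvdn : (order %| #|S| ^ 2)%N.
  apply: (reversible_diffset_order_dvdn _ cardS oppS).
    exact: difference_set_count diffset_S.
  exact: zero_notin_cyc_class.
have order_coprime : coprime order (#|S| ^ 2).
  rewrite coprimeXr // cardS /coprime gcdnDl gcdnC.
  by rewrite /order addnC mulnC gcdnMDl gcdn1.
have order1 : order = 1%N.
  by move: order_coprime; rewrite /coprime (gcdn_idPl order_dvdn) => /eqP.
have : (1 < n %/ d)%N by rewrite ltn_divRL // mul1n.
by move: order1; rewrite card_res /order; nia.
Qed.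

End PowerResidueDifferenceSets.

Section PhiCriteria.
Variables (F : finFieldType) (alpha : F) (e eps : nat).
Local Notation n := #|F|.-1.
Local Notation f := (n %/ e)%N.
Local Notation D := (@class_partition F alpha e eps).
Local Notation phi := (phi alpha e eps).
Hypothesis alpha_prim : n.-primitive_root alpha.
Hypotheses (e_n : (e %| n)%N) (eps_e : (eps %| e)%N).

Let n_gt0 : (0 < n)%N. Proof. exact: prim_order_gt0 alpha_prim. Qed.
Let e_gt0 : (0 < e)%N. Proof. exact: dvdn_gt0 e_n. Qed.
Let eps_n : (eps %| n)%N. Proof. exact: dvdn_trans eps_e e_n. Qed.
Let eps_gt0 : (0 < eps)%N. Proof. exact: dvdn_gt0 eps_n. Qed.
Let f_gt0 : (0 < f)%N. Proof. by rewrite divn_gt0 // dvdn_leq. Qed.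
Let mf_gt0 : (0 < e %/ eps * f)%N.
Proof. by rewrite muln_gt0 f_gt0 divn_gt0 // dvdn_leq. Qed.
Let nE : n = (e %/ eps * f * eps)%N.
Proof. by rewrite mulnAC divnK // mulnC divnK. Qed.

Lemma class_partition_family : disjoint_family #|F| f D.
Proof.
split=> // [j|j|i j]; last exact: class_partition_disjoint.
  by rewrite -disjoints_subset disjoint_sym disjoints1 zero_notin_cyc_class.
exact: card_cyc_class.
Qed.

Lemma internal_count_phi i z : z \in cyc_class alpha eps i ->
  internal_count D z = phi i.
Proof.
move=> Cz; have z0 := mem_cyc_class_neq0 alpha_prim Cz.
rewrite (internal_count_coset (H := cyc_class alpha e 0)) //; first last.
- by move=> j x y; apply: cyc_class_div.
- by rewrite class_partition_union // zero_notin_cyc_class.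
- exact: class_partition_disjoint.
rewrite class_partition_union //; apply: eq_card => u.
rewrite !inE imset_mul_cyc_class; congr (_ && _); apply: andb_id2l => u1.
apply/idP/idP => [Cw | Cu]; last first.
  by rewrite -(cyc_class_div alpha_prim z eps_n Cu).
rewrite -(cyc_classM alpha_prim i (u - 1) eps_n Cw) addn0 mulrC divfK //.
by rewrite subr_eq0.
Qed.

Lemma forall_internal_countP (P : bool -> nat -> Prop) :
  (forall z, z != 0 -> P (z \in family_union D) (internal_count D z)) <->
  P true (phi 0) /\ forall i, (0 < i < eps)%N -> P false (phi i).
Proof.
rewrite class_partition_union //; split=> [Pz | [P0 Pi] z z0].
  have Pphi i : P (i == 0 %[mod eps]) (phi i).
    have Ci : alpha ^+ i \in cyc_class alpha eps i by rewrite mem_cyc_class_exp.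
    have := Pz _ (mem_cyc_class_neq0 alpha_prim Ci).
    by rewrite (internal_count_phi Ci) mem_cyc_class_exp.
  split=> [|i /andP[i_gt0 i_eps]]; first by have := Pphi 0; rewrite eqxx.
  by have := Pphi i; rewrite mod0n modn_small // eqn0Ngt i_gt0.
have [i i_eps Cz] := cyc_classP alpha_prim eps_n z0.
rewrite (internal_count_phi Cz); have [i0 | i_gt0] := posnP i.
  by rewrite -i0 Cz i0.
have i_neq0 : 0 != i by rewrite eq_sym -lt0n.
have disjC := cyc_class_disjoint alpha_prim eps_n eps_gt0 i_eps i_neq0.
by rewrite (disjointFl disjC Cz); apply: Pi; rewrite i_gt0.
Qed.

Lemma class_partition_dpdfP q k lambda mu : disjoint_family q k D ->
  dpdf_with q k lambda mu D <->
  phi 0 = lambda /\ forall i, (0 < i < eps)%N -> phi i = mu.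
Proof.
move=> famD; rewrite (dpdfP _ _ famD).
exact: (forall_internal_countP (fun b c => c = if b then lambda else mu)).
Qed.

Lemma class_partition_ddf_card q c :
  disjoint_difference_family q f c D -> (f - 1 = c * eps)%N.
Proof.
move=> ddfD; have [[cardF _ _ _] _] := ddfD; have := ddf_card ddfD.
rewrite -cardF [in RHS]nE mulnA [in RHS]mulnCA => /eqP.
by rewrite eqn_pmul2l // subn1 => /eqP.
Qed.

Lemma class_partition_edf_card q c :
  external_difference_family q f c D -> ((e - eps) * f = c * eps ^ 2)%N.
Proof.
move=> edfD; have [[cardF _ _ _] _] := edfD; have := edf_card edfD.
rewrite -cardF [in RHS]nE -mulnn mulnA mulnACA [in RHS]mulnCA => /eqP.
rewrite eqn_pmul2l // => /eqP ext_card.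
rewrite -[X in (X - _)%N](divnK eps_e) -[X in (_ - X)%N]mul1n -mulnBl subn1.
by rewrite mulnAC ext_card -mulnA mulnn.
Qed.

Definition phi_constant : Prop := forall i, (i < eps)%N -> phi i = phi 0.

Lemma phi_constant_ddf :
  phi_constant -> disjoint_difference_family #|F| f (phi 0) D.
Proof.
move=> phi_c; apply/ddf_dpdf/(class_partition_dpdfP _ _ class_partition_family).
by split=> // i /andP[_ /phi_c].
Qed.

Section DifferenceSetUnion.
Variables (q k lambda : nat).
Hypothesis diffset_S : difference_set q k lambda (cyc_class alpha eps 0).

Lemma class_partition_epdfP q' k' lambda' mu : disjoint_family q' k' D ->
  epdf_with q' k' lambda' mu D <->
  (phi 0 + lambda' = lambda)%N /\
  forall i, (0 < i < eps)%N -> (phi i + mu = lambda)%N.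
Proof.
move=> famD; rewrite (epdfP (c := lambda) _ _ famD).
  exact: (forall_internal_countP
    (fun b t => t + (if b then lambda' else mu) = lambda)%N).
by rewrite class_partition_union //; apply: difference_set_count diffset_S.
Qed.

Lemma phi0_le_lambda : (phi 0 <= lambda)%N.
Proof.
have := internal_count_le class_partition_family (oner_neq0 F).
rewrite (internal_count_phi (mem1_cyc_class _ _)) class_partition_union //.
by rewrite (difference_set_count diffset_S (oner_neq0 F)).
Qed.

Lemma phi_constant_edf :
  phi_constant -> external_difference_family #|F| f (lambda - phi 0) D.
Proof.
move=> phi_c; apply/edf_epdf/(class_partition_epdfP _ _ class_partition_family).
by split=> [|i /andP[_ /phi_c->]]; apply/subnKC/phi0_le_lambda.
Qed.

Hypothesis eps_proper : (1 < eps < e)%N.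

Lemma phi_repeats_phi0 : exists2 i, (0 < i < eps)%N & phi i = phi 0.
Proof.
have [eps_gt1 eps_lt_e] := andP eps_proper.
have N1_notin : -1 \notin cyc_class alpha eps 0.
  apply: (oppr1_notin_power_residue_diffset alpha_prim eps_n diffset_S).
  by rewrite eps_gt1 (leq_trans eps_lt_e) // dvdn_leq.
have N1_neq0 : -1 != 0 :> F by rewrite oppr_eq0 oner_neq0.
have [i i_eps Ci] := cyc_classP alpha_prim eps_n N1_neq0.
exists i; first by rewrite i_eps lt0n andbT; apply: contraNneq N1_notin => <-.
rewrite -(internal_count_phi Ci) internal_countN.
exact/internal_count_phi/mem1_cyc_class.
Qed.

Lemma phi_constant_pos c :
  (forall i, (0 < i < eps)%N -> phi i = c) -> phi_constant.
Proof.
move=> phi_c i i_eps; have [j j_range phi_j] := phi_repeats_phi0.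
by have [-> // | i_gt0] := posnP i; rewrite -phi_j !phi_c ?i_gt0.
Qed.

Lemma phi_constantP :
  phi_constant <->
  ~ exists i j, [/\ (1 <= i <= eps - 1)%N, (1 <= j <= eps - 1)%N, i <> j
                  & phi i <> phi j].
Proof.
have range i : (1 <= i <= eps - 1)%N = (0 < i < eps)%N.
  by rewrite leq_subRL // addn1.
split=> [phi_c [i [j []]] | same].
  by rewrite !range => /andP[_ i_eps] /andP[_ j_eps] _; rewrite !phi_c.
apply: (@phi_constant_pos (phi 1)) => i i_range.
apply/eqP/negPn/negP => /eqP phi_neq; apply: same; exists i, 1.
have [eps_gt1 _] := andP eps_proper.
by rewrite !range; split=> // i1; apply: phi_neq; rewrite i1.
Qed.

Lemma dpdf_phi_constant k' lambda' mu :
  dpdf_with #|F| k' lambda' mu D -> phi_constant /\ lambda' = mu.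
Proof.
move=> dpdfD; have [famD _] := dpdfD; have [eps_gt1 _] := andP eps_proper.
have [phi0 phi_mu] := (class_partition_dpdfP _ _ famD).1 dpdfD.
have phi_c := phi_constant_pos phi_mu.
by split=> //; rewrite -phi0 -(phi_c 1) ?phi_mu.
Qed.

Lemma epdf_phi_constant k' lambda' mu :
  epdf_with #|F| k' lambda' mu D -> phi_constant /\ lambda' = mu.
Proof.
move=> epdfD; have [famD _] := epdfD; have [eps_gt1 _] := andP eps_proper.
have [phi0 phi_mu] := (class_partition_epdfP _ _ famD).1 epdfD.
have phi_c : phi_constant.
  by apply: (@phi_constant_pos (lambda - mu)) => i /phi_mu <-; rewrite addnK.
by split=> //; apply: (@addnI (phi 0)); rewrite phi0 -(phi_c 1) ?phi_mu.
Qed.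

End DifferenceSetUnion.
End PhiCriteria.

Local Close Scope ring_scope.

Theorem theorem5p1 (F : finFieldType) (alpha : F) (q e f epsilon lambda : nat)
  (hF : #|F| = q)
  (hq : q = e * f + 1)
  (he : 1 < e) (hf : 1 < f)
  (halpha : ((q - 1)%N.-primitive_root alpha)%R)
  (heps1 : 1 < epsilon) (hepse : epsilon %| e) (hepslt : epsilon < e)
  (hD : difference_set q ((q - 1) %/ epsilon) lambda
          (cyc_class alpha epsilon 0)) :
  let D := @class_partition F alpha e epsilon in
  let differing := exists i j : nat,
    [/\ 1 <= i <= epsilon - 1, 1 <= j <= epsilon - 1, i <> j
      & phi alpha e epsilon i <> phi alpha e epsilon j] in
  [/\ lambda * epsilon ^ 2 = q - 1 - epsilon,
      differing ->
        ~ disjoint_partial_difference_family D /\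
        ~ external_partial_difference_family D,
      ~ differing ->
        [/\ epsilon %| f - 1,
            disjoint_difference_family q f ((f - 1) %/ epsilon) D,
            epsilon ^ 2 %| (e - epsilon) * f
          & external_difference_family q f
              ((e - epsilon) * f %/ epsilon ^ 2) D]
    & ~ proper_dpdf D /\ ~ proper_epdf D].
Proof.
move=> D differing.
have qE : q - 1 = #|F|.-1 by rewrite hF subn1.
have nE : #|F|.-1 = e * f by rewrite hF hq addn1.
rewrite qE in halpha hD *.
have e_n : e %| #|F|.-1 by rewrite nE dvdn_mulr.
have fE : #|F|.-1 %/ e = f by rewrite nE mulKn // ltnW.
have eps_n := dvdn_trans hepse e_n; have eps_gt0 : 0 < epsilon := ltnW heps1.
have eps_proper : 1 < epsilon < e by rewrite heps1.
have constP := phi_constantP halpha e_n hepse hD eps_proper.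
have dpdf_const := dpdf_phi_constant halpha e_n hepse hD eps_proper.
have epdf_const := epdf_phi_constant halpha e_n hepse hD eps_proper.
split.
- rewrite -[in RHS](divnK eps_n) (power_residue_diffset_card halpha eps_n hD).
  by rewrite mulnDl mul1n addKn -mulnA.
- move=> diff.
  by split=> -[k [c [c']]] => [/dpdf_const | /epdf_const] [/constP].
- move=> /constP phi_c; have ddfD := phi_constant_ddf halpha e_n hepse phi_c.
  have edfD := phi_constant_edf halpha e_n hepse hD phi_c.
  rewrite -hF -fE (class_partition_edf_card halpha e_n hepse edfD).
  rewrite (class_partition_ddf_card halpha e_n hepse ddfD).
  by rewrite !mulnK ?expn_gt0 ?eps_gt0 //; split=> //; apply: dvdn_mull.
- by split=> -[k [c [c' [neq]]]] => [/dpdf_const | /epdf_const] [_].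
Qed.
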